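(* Let $X$ be a topological space and let $A, B\subseteq X$ be subsets such that $A^{\circ}\cup B^{\circ} = X$ (interiors taken in $X$). Let $\{X_i\}_{i\in\mathbb{N}}$ be a filtration of $X$, and let $\{A_i\}_{i\in\mathbb{N}}$ and $\{B_i\}_{i\in\mathbb{N}}$ be the induced filtrations on $A$ and $B$, i.e. $A_i = A\cap X_i$ and $B_i = B\cap X_i$ for each $i$. Then $$X_i = A_i^{\circ}\cup B_i^{\circ}$$ for all $i$, where the interiors of $A_i$ and $B_i$ are taken in $X_i$ with its subspace topology from $X$.
   Context: A filtration $\{X_i\}_{i\in\mathbb{N}}$ of a topological space $X$ is a family of subspaces $X_i\subseteq X$ with $X_i\subseteq X_j$ whenever $i\le j$. All subspaces of $X$ carry the subspace topology. For $S\subseteq U\subseteq X$, the interior of $S$ in $U$ is the largest subset of $S$ that is open in the subspace topology on $U$. *)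

(* Defs.v *)
From mathcomp Require Import all_boot all_order.
From mathcomp Require Import all_classical all_analysis.

Set Implicit Arguments.
Unset Strict Implicit.
Unset Printing Implicit Defensive.

Local Open Scope classical_set_scope.

Definition filtration (T : Type) (F : nat -> set T) : Prop :=
  forall i j : nat, (i <= j)%N -> F i `<=` F j.

Definition induced_filtration (T : Type) (F : nat -> set T) (A : set T) :
  nat -> set T := fun i => A `&` F i.

(* The type [set_type U] carries the initial topology of the inclusion
   [set_val : set_type U -> T], i.e. the subspace topology. The interior is
   taken there and then mapped back into [T]. We do not use [subspace U]:
   its carrier is all of [T], with the points outside [U] isolated.
   Meaningful for [S `<=` U] (otherwise the interior is that of [S `&` U]). *)
Definition interior_in (T : topologicalType) (U S : set T) : set T :=
  set_val @` ((set_val @^-1` S : set (set_type U))°).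

(* Main.v *)
Require Import Defs.
From mathcomp Require Import all_boot all_order.
From mathcomp Require Import all_classical all_analysis.

(** The inclusion of a subspace [U] into [T] is continuous, so it pulls
    neighbourhoods in [T] back to neighbourhoods in [U]: a point of [U] interior
    to [A] in [T] is interior to the trace [A `&` U] in [U]
    ([setI_interior_sub_interior_in]). Every point of [X i] is interior to [A]
    or to [B], hence to one of their traces on [X i]. The converse inclusion
    holds because an interior taken in [X i] consists of points of [X i]. *)

Local Open Scope classical_set_scope.

Lemma interior_in_sub (T : topologicalType) (U S : set T) :
  interior_in U S `<=` U.
Proof. by move=> _ [p _ <-]; exact: set_valP. Qed.

(** The inclusion may be strict, since [A] need not be a neighbourhood in [T]
    for its trace to be one in [U]; only this direction follows from
    continuity of [set_val]. *)
Lemma setI_interior_sub_interior_in (T : topologicalType) (U A : set T) :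
  A° `&` U `<=` interior_in U (A `&` U).
Proof.
move=> x [Ax Ux].
pose p : set_type U := SigSub (mem_set Ux).
exists p => //.
have cont : continuous (set_val : set_type U -> T) by exact: initial_continuous.
have nA : nbhs p (set_val @^-1` A) by exact: (cont p A Ax).
by apply: filterS nA => q Aq; split => //; exact: set_valP.
Qed.

Theorem lemma1 (T : topologicalType) (A B : set T)
  (hAB : A° `|` B° = [set: T])
  (X : nat -> set T) (hX : filtration X) (i : nat) :
  X i = interior_in (X i) (induced_filtration X A i) `|`
        interior_in (X i) (induced_filtration X B i).
Proof.
apply/seteqP; split => [x Xx|x [] /interior_in_sub //].
have : (A° `|` B°) x by rewrite hAB.
by case=> [Ax|Bx]; [left|right]; exact: setI_interior_sub_interior_in.
Qed.
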